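(* Let $R$ be an associative unital algebra over $\mathbb C$ and let $T(z)$ be an $n\times n$ Lax matrix of Yangian type over $R$. Then $$T(z)e^{-\partial_z}\qquad\text{and}\qquad (e^{\partial_z}T(z))^t$$ are Manin matrices. Moreover, for every $c\in\mathbb C$ the matrix $T(z+c)$ is also a Lax matrix of Yangian type, so that $$T(z+c)e^{-\partial_z}=e^{-\partial_z}T(z+c+1)\qquad\text{and}\qquad (e^{\partial_z}T(z+c))^t=(T(z+c+1)e^{\partial_z})^t$$ are Manin matrices.
   Context: A matrix $M$ with entries $M_{ij}$ in a (not necessarily commutative) associative ring is called a Manin matrix if (1) elements in the same column commute with each other, and (2) $[M_{ij},M_{kl}]=[M_{kj},M_{il}]$ for all $i,j,k,l$. An $n\times n$ matrix $T(z)$ whose entries are $R$-valued functions of the formal parameter $z$ (elements of $R((z^{-1}))$, or rational functions of $z$ with coefficients in $R$) is called a Lax matrix of Yangian type if $$[T_{ij}(u),T_{kl}(v)]=\frac{1}{u-v}\bigl(T_{kj}(u)T_{il}(v)-T_{kj}(v)T_{il}(u)\bigr)$$ for all $i,j,k,l$. The shift operator $e^{a\partial_z}$ satisfies $e^{a\partial_z}f(z)=f(z+a)e^{a\partial_z}$ and commutes with $R$; shifts $f(z+a)$ of elements of $R((z^{-1}))$ are expanded in $z^{-1}$. The superscript $t$ denotes transposition. *)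

(* Defs.v *)
From HB Require Import structures.
From mathcomp Require Import all_boot all_order all_algebra.
From mathcomp Require Import boolp classical_sets functions cardinality fsbigop.
From mathcomp Require Import reals.
From mathcomp Require Import zify.
From mathcomp.real_closed Require Export complex.

Set Implicit Arguments.
Unset Strict Implicit.
Unset Printing Implicit Defensive.

Import Order.TTheory GRing.Theory Num.Theory.
Local Open Scope ring_scope.

Definition lie (A : pzRingType) (x y : A) : A := x * y - y * x.

Definition manin (A : pzRingType) (m n : nat) (M : 'M[A]_(m, n)) : Prop :=
  (forall i k j, lie (M i j) (M k j) = 0) /\
  (forall i j k l, lie (M i j) (M k l) = lie (M k j) (M i l)).

(* Additive operators on V under composition; the wrapper is needed because
   plain functions already carry the pointwise product. *)
Section Endo.
Variable V : zmodType.

Record endo := Endo { endo_fun :> V -> V; _ : `[< zmod_morphism endo_fun >] }.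
HB.instance Definition _ := [isSub for endo_fun].
HB.instance Definition _ := [Choice of endo by <:].
Implicit Types f g h : endo.

Definition mkEndo (f : V -> V) (fP : zmod_morphism f) : endo :=
  Endo (introT (asboolP _) fP).

Lemma endoB f : zmod_morphism f.
Proof. by case: f => f fP; exact: asboolW fP. Qed.

Lemma endoP f g : f =1 g -> f = g.
Proof. by move=> fg; apply/val_inj/funext. Qed.

Lemma endo0 f : f 0 = 0.
Proof. by rewrite -[in LHS](subrr 0) endoB subrr. Qed.
Lemma endoN f : {morph f : x / - x}.
Proof. by move=> x; rewrite -sub0r endoB endo0 sub0r. Qed.
Lemma endoD f : {morph f : x y / x + y}.
Proof. by move=> x y; rewrite -[y]opprK endoB endoN !opprK. Qed.

Definition endo_zero : endo := @mkEndo (fun=> 0) (fun _ _ => esym (subrr 0)).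
Lemma endo_opp_subproof f : zmod_morphism (fun x => - f x).
Proof. by move=> x y; rewrite endoB opprB opprK addrC. Qed.
Definition endo_opp f := mkEndo (endo_opp_subproof f).
Lemma endo_add_subproof f g : zmod_morphism (fun x => f x + g x).
Proof. by move=> x y; rewrite !endoB opprD addrACA. Qed.
Definition endo_add f g := mkEndo (endo_add_subproof f g).
Definition endo_one : endo := @mkEndo id (fun _ _ => erefl).
Lemma endo_comp_subproof f g : zmod_morphism (fun x => f (g x)).
Proof. by move=> x y; rewrite !endoB. Qed.
Definition endo_comp f g := mkEndo (endo_comp_subproof f g).

Lemma endo_addA : associative endo_add.
Proof. by move=> f g h; apply: endoP => x /=; rewrite addrA. Qed.
Lemma endo_addC : commutative endo_add.
Proof. by move=> f g; apply: endoP => x /=; rewrite addrC. Qed.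
Lemma endo_add0 : left_id endo_zero endo_add.
Proof. by move=> f; apply: endoP => x /=; rewrite add0r. Qed.
Lemma endo_addN : left_inverse endo_zero endo_opp endo_add.
Proof. by move=> f; apply: endoP => x /=; rewrite addNr. Qed.
HB.instance Definition _ :=
  GRing.isZmodule.Build endo endo_addA endo_addC endo_add0 endo_addN.

Lemma endo_mulA : associative endo_comp.
Proof. by move=> f g h; apply: endoP. Qed.
Lemma endo_mul1 : left_id endo_one endo_comp.
Proof. by move=> f; apply: endoP. Qed.
Lemma endo_mul_1 : right_id endo_one endo_comp.
Proof. by move=> f; apply: endoP. Qed.
Lemma endo_mulDl : left_distributive endo_comp +%R.
Proof. by move=> f g h; apply: endoP. Qed.
Lemma endo_mulDr : right_distributive endo_comp +%R.
Proof. by move=> f g h; apply: endoP => x /=; rewrite endoD. Qed.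
HB.instance Definition _ := GRing.Zmodule_isPzRing.Build endo
  endo_mulA endo_mul1 endo_mul_1 endo_mulDl endo_mulDr.

Lemma endoME f g x : (f * g) x = f (g x). Proof. by []. Qed.
Lemma endoDE f g x : (f + g) x = f x + g x. Proof. by []. Qed.
Lemma endoNE f x : (- f) x = - f x. Proof. by []. Qed.
End Endo.

(* Rings of functions of one variable z, with the shifts f(z) |-> f(z + a). *)
HB.mixin Record hasShift (C : numFieldType) F of GRing.NzRing F := {
  shift : C -> F -> F;
  shiftB : forall a, zmod_morphism (shift a)
}.
#[short(type="shiftRingType")]
HB.structure Definition ShiftRing (C : numFieldType) :=
  {F of GRing.NzRing F & hasShift C F}.

Section DifferenceOperators.
Variables (C : numFieldType) (F : shiftRingType C).

Definition mulop (f : F) : endo F := mkEndo (@mulrBr F f).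

(* e^{a d/dz}; it fixes 1, so the operator f e^{a d/dz} determines f. *)
Definition shiftop (a : C) : endo F := mkEndo (@shiftB C F a).

Definition mx_shiftop n (T : 'M[F]_n) (a : C) : 'M[endo F]_n :=
  \matrix_(i, j) (mulop (T i j) * shiftop a).
Definition shiftop_mx n (a : C) (T : 'M[F]_n) : 'M[endo F]_n :=
  \matrix_(i, j) (shiftop a * mulop (T i j)).
End DifferenceOperators.

(* The ring R((z^-1)): f k is the coefficient of z^k and vanishes for all
   sufficiently large k. *)
Section Laurent.
Variable R : nzRingType.

Definition bounded_above (f : int -> R) :=
  exists N : int, forall k, N < k -> f k = 0.

Record laurent :=
  Laurent { laurent_coef :> int -> R; _ : `[< bounded_above laurent_coef >] }.
HB.instance Definition _ := [isSub for laurent_coef].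
HB.instance Definition _ := [Choice of laurent by <:].
Implicit Types f g h : laurent.

Definition mkLaurent (f : int -> R) (fP : bounded_above f) : laurent :=
  Laurent (introT (asboolP _) fP).

Lemma laurent_bound f : bounded_above f.
Proof. by case: f => f fP; exact: asboolW fP. Qed.

Lemma laurentP f g : f =1 g -> f = g.
Proof. by move=> fg; apply/val_inj/funext. Qed.

Lemma laurent_zero_subproof : bounded_above (fun=> 0).
Proof. by exists 0. Qed.
Definition laurent_zero := mkLaurent laurent_zero_subproof.

Lemma laurent_opp_subproof f : bounded_above (fun k => - f k).
Proof. by have [N fN] := laurent_bound f; exists N => k /fN ->; rewrite oppr0. Qed.
Definition laurent_opp f := mkLaurent (laurent_opp_subproof f).

Lemma laurent_add_subproof f g : bounded_above (fun k => f k + g k).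
Proof.
have [[N fN] [M gM]] := (laurent_bound f, laurent_bound g).
by exists (Num.max N M) => k; rewrite gt_max => /andP[/fN-> /gM->]; rewrite addr0.
Qed.
Definition laurent_add f g := mkLaurent (laurent_add_subproof f g).

Lemma laurent_addA : associative laurent_add.
Proof. by move=> f g h; apply: laurentP => x /=; rewrite addrA. Qed.
Lemma laurent_addC : commutative laurent_add.
Proof. by move=> f g; apply: laurentP => x /=; rewrite addrC. Qed.
Lemma laurent_add0 : left_id laurent_zero laurent_add.
Proof. by move=> f; apply: laurentP => x /=; rewrite add0r. Qed.
Lemma laurent_addN : left_inverse laurent_zero laurent_opp laurent_add.
Proof. by move=> f; apply: laurentP => x /=; rewrite addNr. Qed.
HB.instance Definition _ := GRing.isZmodule.Build laurent
  laurent_addA laurent_addC laurent_add0 laurent_addN.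

(* The constant c, as c * z^0. *)
Lemma laurent_const_subproof (c : R) : bounded_above (fun k => c *+ (k == 0)).
Proof. by exists 0 => k k0; rewrite (gt_eqF k0). Qed.
Definition laurent_const (c : R) := mkLaurent (laurent_const_subproof c).

(* A finitely supported sum. *)
Definition cauchy f g (m : int) : R := \sum_(i \in [set: int]) f i * g (m - i).

Lemma cauchy_poly f g (N M : int) (K k : nat) :
    (forall i, N < i -> f i = 0) -> (forall i, M < i -> g i = 0) -> (k < K)%N ->
  cauchy f g (N + M - k%:Z) =
  (\poly_(i < K) f (N - i%:Z) * \poly_(i < K) g (M - i%:Z))`_k.
Proof.
move=> fN gM kK; rewrite coefM /cauchy.
pose s := [seq N - i%:Z | i <- iota 0 k.+1].
have s_uniq : uniq s by rewrite map_inj_uniq ?iota_uniq// => i j; lia.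
rewrite (fsbigE s) //; last first.
  move=> i _ ins; have [/fN->|iN] := ltP N i; first by rewrite mul0r.
  rewrite [g _]gM ?mulr0//; rewrite ltNge; apply: contra ins => le.
  apply/mapP; exists `|N - i|%N; last by lia.
  by rewrite mem_iota; lia.
rewrite /s big_map (eq_bigl xpredT) => [|i]; last by rewrite in_setT.
rewrite -[iota _ _]/(index_iota 0 k.+1) big_mkord; apply: eq_bigr => i _.
have ik := ltn_ord i; rewrite !coef_poly !ifT; [|lia..].
by congr (_ * g _); lia.
Qed.

Lemma cauchy_gt f g (N M m : int) :
    (forall i, N < i -> f i = 0) -> (forall i, M < i -> g i = 0) ->
  N + M < m -> cauchy f g m = 0.
Proof.
move=> fN gM ltm; apply: fsbig1 => i _.
have [/fN->|iN] := ltP N i; first by rewrite mul0r.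
by rewrite [g _]gM ?mulr0//; lia.
Qed.

Lemma laurent_mul_subproof f g : bounded_above (cauchy f g).
Proof.
have [[N fN] [M gM]] := (laurent_bound f, laurent_bound g).
by exists (N + M) => m; apply: cauchy_gt.
Qed.
Definition laurent_mul f g := mkLaurent (laurent_mul_subproof f g).

Lemma laurent_mulA : associative laurent_mul.
Proof.
move=> f g h; apply: laurentP => m.
have [N fN] := laurent_bound f; have [M gM] := laurent_bound g.
have [P hP] := laurent_bound h.
have fgNM : forall i, N + M < i -> laurent_mul f g i = 0.
  by move=> i; apply: cauchy_gt.
have ghMP : forall i, M + P < i -> laurent_mul g h i = 0.
  by move=> i; apply: cauchy_gt.
have [ltm|lem] := ltP (N + M + P) m.
  by rewrite /= (cauchy_gt fN ghMP) ?(cauchy_gt fgNM hP)//; lia.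
pose k := absz (N + M + P - m)%R; pose K := k.+1.
have mE : m = N + (M + P) - k%:Z by lia.
have mE' : m = (N + M) + P - k%:Z by lia.
rewrite /= {1}mE mE' (cauchy_poly fN ghMP (ltnSn k)).
rewrite (cauchy_poly fgNM hP (ltnSn k)).
transitivity ((\poly_(i < K) f (N - i%:Z) *
   (\poly_(i < K) g (M - i%:Z) * \poly_(i < K) h (P - i%:Z)))`_k).
  rewrite !coefM; apply: eq_bigr => i _; congr (_ * _).
  by rewrite coef_poly ltnS leq_subr /= (@cauchy_poly _ _ _ _ K)// ltnS leq_subr.
rewrite mulrA !coefM; apply: eq_bigr => i _; congr (_ * _).
by rewrite coef_poly ltn_ord /= (@cauchy_poly _ _ _ _ K).
Qed.

Lemma laurent_mul1 : left_id (laurent_const 1) laurent_mul.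
Proof.
move=> f; apply: laurentP => m; rewrite /= /cauchy (fsbigE [:: 0])//=.
  by rewrite big_cons big_nil in_setT /= mulr1n mul1r subr0 addr0.
by move=> i _; rewrite inE => /negPf ->; rewrite mul0r.
Qed.

Lemma laurent_mul_1 : right_id (laurent_const 1) laurent_mul.
Proof.
move=> f; apply: laurentP => m; rewrite /= /cauchy (fsbigE [:: m])//=.
  by rewrite big_cons big_nil in_setT /= subrr mulr1n mulr1 addr0.
move=> i _; rewrite inE => im; rewrite subr_eq0 eq_sym (negPf im).
by rewrite mulr0n mulr0.
Qed.

Lemma laurent_mulDl : left_distributive laurent_mul laurent_add.
Proof.
move=> f g h; apply: laurentP => m /=.
have [N1 fN] := laurent_bound f; have [N2 gN] := laurent_bound g.
have [P hP] := laurent_bound h; pose N := Num.max N1 N2.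
have {}fN i : N < i -> f i = 0 by rewrite gt_max => /andP[/fN].
have {}gN i : N < i -> g i = 0 by rewrite gt_max => /andP[_ /gN].
have fgN i : N < i -> laurent_add f g i = 0.
  by move=> Ni /=; rewrite fN ?gN ?addr0.
have [ltm|lem] := ltP (N + P) m.
  by rewrite (cauchy_gt fgN hP) ?(cauchy_gt fN hP) ?(cauchy_gt gN hP) ?addr0.
have mE : m = N + P - (absz (N + P - m)%R)%:Z by lia.
rewrite mE; set k := absz _.
rewrite (cauchy_poly fgN hP (ltnSn k)) (cauchy_poly fN hP (ltnSn k)).
rewrite (cauchy_poly gN hP (ltnSn k)) -coefD -mulrDl.
have -> // : \poly_(i < k.+1) laurent_add f g (N - i%:Z) =
  \poly_(i < k.+1) f (N - i%:Z) + \poly_(i < k.+1) g (N - i%:Z).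
by apply/polyP => i; rewrite coefD !coef_poly; case: ifP; rewrite ?addr0.
Qed.

Lemma laurent_mulDr : right_distributive laurent_mul laurent_add.
Proof.
move=> f g h; apply: laurentP => m /=.
have [N fN] := laurent_bound f; have [P1 gP] := laurent_bound g.
have [P2 hP] := laurent_bound h; pose P := Num.max P1 P2.
have {}gP i : P < i -> g i = 0 by rewrite gt_max => /andP[/gP].
have {}hP i : P < i -> h i = 0 by rewrite gt_max => /andP[_ /hP].
have ghP i : P < i -> laurent_add g h i = 0.
  by move=> Pi /=; rewrite gP ?hP ?addr0.
have [ltm|lem] := ltP (N + P) m.
  by rewrite (cauchy_gt fN ghP) ?(cauchy_gt fN gP) ?(cauchy_gt fN hP) ?addr0.
have mE : m = N + P - (absz (N + P - m)%R)%:Z by lia.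
rewrite mE; set k := absz _.
rewrite (cauchy_poly fN ghP (ltnSn k)) (cauchy_poly fN gP (ltnSn k)).
rewrite (cauchy_poly fN hP (ltnSn k)) -coefD -mulrDr.
have -> // : \poly_(i < k.+1) laurent_add g h (P - i%:Z) =
  \poly_(i < k.+1) g (P - i%:Z) + \poly_(i < k.+1) h (P - i%:Z).
by apply/polyP => i; rewrite coefD !coef_poly; case: ifP; rewrite ?addr0.
Qed.

Lemma laurent_1neq0 : laurent_const 1 != 0.
Proof.
by apply/eqP => /(congr1 (fun f : laurent => f 0)) /eqP; rewrite /= oner_eq0.
Qed.

HB.instance Definition _ := GRing.Zmodule_isNzRing.Build laurent
  laurent_mulA laurent_mul1 laurent_mul_1 laurent_mulDl laurent_mulDr
  laurent_1neq0.

Lemma laurentDE f g k : (f + g) k = f k + g k. Proof. by []. Qed.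
Lemma laurentNE f k : (- f) k = - f k. Proof. by []. Qed.
Lemma laurentME f g k :
  (f * g) k = \sum_(i \in [set: int]) f i * g (k - i).
Proof. by []. Qed.
End Laurent.

Section LaurentShift.
Variables (C : numFieldType) (R : algType C).
Implicit Types f g : laurent R.

(* k (k - 1) ... (k - j + 1) / j!, so that
   (z + a)^k = \sum_j binz k j a^j z^(k - j). *)
Definition binz (k : int) (j : nat) : C :=
  (\prod_(i < j) (k%:~R - i%:R)) / j`!%:R.

Definition shift_coef (a : C) f (m : int) : R :=
  \sum_(j \in [set: nat]) (binz (m + j%:Z) j * a ^+ j) *: f (m + j%:Z).

Lemma shift_coefE a f (N m : int) (K : nat) :
    (forall i, N < i -> f i = 0) -> N < m + K%:Z ->
  shift_coef a f m =
  \sum_(j < K) (binz (m + j%:Z) j * a ^+ j) *: f (m + j%:Z).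
Proof.
move=> fN ltN; rewrite /shift_coef (fsbigE (iota 0 K)) ?iota_uniq//.
  rewrite (eq_bigl xpredT) => [|i]; last by rewrite in_setT.
  by rewrite (_ : iota 0 K = index_iota 0 K) ?big_mkord// /index_iota subn0.
move=> i _; rewrite mem_iota /= add0n -leqNgt => Ki.
by rewrite fN ?scaler0//; lia.
Qed.

Lemma shift_coef_subproof a f : bounded_above (shift_coef a f).
Proof.
have [N fN] := laurent_bound f; exists N => m Nm.
by rewrite (@shift_coefE a f N m 0)// ?big_ord0// addr0.
Qed.
Definition laurent_shift a f := mkLaurent (shift_coef_subproof a f).

Lemma laurent_shiftB a : zmod_morphism (laurent_shift a).
Proof.
move=> f g; apply: laurentP => m.
rewrite laurentDE laurentNE /=.
have [N1 fN] := laurent_bound f; have [N2 gN] := laurent_bound g.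
pose N := Num.max N1 N2.
have {}fN i : N < i -> f i = 0 by rewrite gt_max => /andP[/fN].
have {}gN i : N < i -> g i = 0 by rewrite gt_max => /andP[_ /gN].
have fgN i : N < i -> (f - g) i = 0.
  by move=> Ni; rewrite laurentDE laurentNE fN ?gN ?subr0.
have [K ltK] : exists K : nat, N < m + K%:Z by exists (absz (N - m)%R).+1; lia.
rewrite (shift_coefE a fgN ltK) (shift_coefE a fN ltK) (shift_coefE a gN ltK).
by rewrite -sumrB; apply: eq_bigr => j _; rewrite -scalerBr.
Qed.

HB.instance Definition _ := hasShift.Build C (laurent R) laurent_shiftB.
End LaurentShift.

(* Series in two variables: h p q is the coefficient of u^p v^q. *)
Section LaurentLax.
Variable R : nzRingType.
Implicit Types (f g : laurent R) (h : int -> int -> R).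

(* f(u) g(v) and f(v) g(u). *)
Definition prod_uv f g : int -> int -> R := fun p q => f p * g q.
Definition prod_vu f g : int -> int -> R := fun p q => f q * g p.

(* h / (u - v), with 1 / (u - v) = \sum_(n >= 0) u^(- n - 1) v^n. *)
Definition div_uv h : int -> int -> R :=
  fun p q => \sum_(n \in [set: nat]) h (p + n%:Z + 1) (q - n%:Z).

(* (u - v) h *)
Definition mul_uv h : int -> int -> R := fun p q => h (p - 1) q - h p (q - 1).

Definition laurent_yangian n (T : 'M[laurent R]_n) : Prop :=
  forall i j k l,
    prod_uv (T i j) (T k l) - prod_vu (T k l) (T i j) =
    div_uv (prod_uv (T k j) (T i l) - prod_vu (T k j) (T i l)).

Lemma div_uvE h (N p q : int) (K : nat) :
    (forall p q, N < p -> h p q = 0) -> N < p + K%:Z + 1 ->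
  div_uv h p q = \sum_(n < K) h (p + n%:Z + 1) (q - n%:Z).
Proof.
move=> hN ltN; rewrite /div_uv (fsbigE (iota 0 K)) ?iota_uniq//.
  rewrite (eq_bigl xpredT) => [|i]; last by rewrite in_setT.
  by rewrite (_ : iota 0 K = index_iota 0 K) ?big_mkord// /index_iota subn0.
move=> i _; rewrite mem_iota /= add0n -leqNgt => Ki.
by rewrite hN//; lia.
Qed.

Lemma div_uvK h (N : int) :
  (forall p q, N < p -> h p q = 0) -> mul_uv (div_uv h) = h.
Proof.
move=> hN; apply/funext => p; apply/funext => q; rewrite /mul_uv.
pose K := (absz (N - p)%R).+1.
rewrite (@div_uvE _ N _ _ K.+1)//; last by lia.
rewrite (@div_uvE _ N _ _ K)//; last by lia.
rewrite big_ord_recl addr0 subrK subr0 -addrA -sumrB big1 ?addr0// => i _.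
rewrite /= /bump /=; apply/eqP; rewrite subr_eq0; apply/eqP.
by congr h; lia.
Qed.

Lemma mul_uvK h (N : int) :
  (forall p q, N < p -> h p q = 0) -> div_uv (mul_uv h) = h.
Proof.
move=> hN; apply/funext => p; apply/funext => q.
have mN p' q' : N + 1 < p' -> mul_uv h p' q' = 0.
  by move=> lt; rewrite /mul_uv !hN ?subr0//; lia.
pose K := (absz (N - p)%R).+1.
rewrite (@div_uvE _ (N + 1) _ _ K)//; last by lia.
rewrite /mul_uv.
rewrite (eq_bigr (fun n : 'I_K => - (h (p + n.+1%:Z) (q - n.+1%:Z) -
   h (p + n%:Z) (q - n%:Z)))) => [|i _].
  rewrite sumrN -(big_mkord xpredT (fun n => h (p + n.+1%:Z) (q - n.+1%:Z) -
     h (p + n%:Z) (q - n%:Z))).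
  rewrite (telescope_sumr (fun n => h (p + n%:Z) (q - n%:Z)))//.
  by rewrite hN ?sub0r ?opprK ?addr0 ?subr0//; lia.
by rewrite opprB; congr (_ - _); congr h; lia.
Qed.

(* The direction in which 1 / (u - v) is expanded does not matter. *)
Lemma laurent_yangianE n (T : 'M[laurent R]_n) :
  laurent_yangian T <-> forall i j k l,
    mul_uv (prod_uv (T i j) (T k l) - prod_vu (T k l) (T i j)) =
    prod_uv (T k j) (T i l) - prod_vu (T k j) (T i l).
Proof.
have bnd f g f' g' : exists N : int, forall p q, N < p ->
    (prod_uv f g - prod_vu f' g') p q = 0.
  have [[N fN] [M gM]] := (laurent_bound f, laurent_bound g').
  exists (Num.max N M) => p q; rewrite gt_max => /andP[/fN fp /gM gp].
  rewrite -[LHS]/(prod_uv f g p q - prod_vu f' g' p q).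
  by rewrite /prod_uv /prod_vu fp gp mul0r mulr0 subr0.
split=> H i j k l.
  by have [N hN] := bnd (T k j) (T i l) (T k j) (T i l); rewrite H (div_uvK hN).
by have [N hN] := bnd (T i j) (T k l) (T k l) (T i j); rewrite -H (mul_uvK hN).
Qed.
End LaurentLax.

(* Fractions over A with denominators from a commutative domain D that maps to
   central non-zero-divisors of A. *)
Record denominators (D : idomainType) (A : nzRingType) := Denominators {
  denom_map :> {rmorphism D -> A};
  denom_comm : forall d x, denom_map d * x = x * denom_map d;
  denom_reg : forall d, d != 0 -> GRing.rreg (denom_map d)
}.

Section Localization.
Local Open Scope quotient_scope.
Variables (D : idomainType) (A : nzRingType) (phi : denominators D A).

Record lratio := LRatio { lfrac :> A * D; _ : lfrac.2 != 0 }.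
HB.instance Definition _ := [isSub for lfrac].
HB.instance Definition _ := [Choice of lratio by <:].
Implicit Types x y z : lratio.

Lemma lratioP x : x.2 != 0. Proof. by case: x. Qed.

Definition lratio_equiv x y := x.1 * phi y.2 == y.1 * phi x.2.

Lemma lratio_refl : reflexive lratio_equiv.
Proof. by move=> x; rewrite /lratio_equiv. Qed.
Lemma lratio_sym : symmetric lratio_equiv.
Proof. by move=> x y; rewrite /lratio_equiv eq_sym. Qed.
Lemma lratio_trans : transitive lratio_equiv.
Proof.
move=> y x z /eqP xy /eqP yz; apply/eqP.
have reg := @denom_reg _ _ phi _ (lratioP y); apply: reg => /=.
by rewrite -mulrA denom_comm mulrA xy -mulrA denom_comm mulrA yz -!mulrA denom_comm.
Qed.
Canonical lratio_equivRel :=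
  EquivRel lratio_equiv lratio_refl lratio_sym lratio_trans.

Definition loc := {eq_quot lratio_equiv}.
HB.instance Definition _ : EqQuotient _ lratio_equiv loc := EqQuotient.on loc.
HB.instance Definition _ := Choice.on loc.

(* The fraction a / d; the junk value for d = 0 is 0. *)
Definition frac (a : A) (d : D) : loc :=
  \pi_loc (insubd (@LRatio (0, 1) (oner_neq0 D)) (a, d)).
Definition numer (f : loc) : A := (repr f).1.
Definition denom (f : loc) : D := (repr f).2.

Lemma denom_neq0 f : denom f != 0. Proof. exact: lratioP. Qed.

Lemma fracP a b d e : d != 0 -> e != 0 ->
  frac a d = frac b e <-> a * phi e = b * phi d.
Proof.
move=> d0 e0; rewrite /frac /insubd !insubT/=; split.
  by move/eqmodP => /= /eqP.
by move=> h; apply/eqmodP/eqP.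
Qed.

Lemma frac_numer_denom f : frac (numer f) (denom f) = f.
Proof.
rewrite -[RHS]reprK /frac; congr (\pi_loc _); apply: val_inj.
by rewrite /insubd insubT ?lratioP//= => _; rewrite /numer /denom -surjective_pairing.
Qed.

Lemma locW (P : loc -> Prop) :
  (forall a d, d != 0 -> P (frac a d)) -> forall f, P f.
Proof. by move=> H f; rewrite -(frac_numer_denom f); apply/H/denom_neq0. Qed.

Lemma numer_frac a d : d != 0 ->
  numer (frac a d) * phi d = a * phi (denom (frac a d)).
Proof. by move=> d0; apply/fracP; rewrite ?denom_neq0// frac_numer_denom. Qed.

Definition loc_add (f g : loc) := frac
  (numer f * phi (denom g) + numer g * phi (denom f)) (denom f * denom g).
Definition loc_opp (f : loc) := frac (- numer f) (denom f).
Definition loc_mul (f g : loc) := frac (numer f * numer g) (denom f * denom g).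

Lemma loc_addE a d b e : d != 0 -> e != 0 ->
  loc_add (frac a d) (frac b e) = frac (a * phi e + b * phi d) (d * e).
Proof.
move=> d0 e0; apply/fracP; rewrite ?mulf_neq0 ?denom_neq0//.
have := numer_frac b e0; have := numer_frac a d0.
set n1 := numer _; set d1 := denom _; set n2 := numer _; set d2 := denom _.
move=> h1 h2; rewrite !mulrDl -!mulrA -!rmorphM; congr (_ + _).
  rewrite (_ : d2 * (d * e) = d * (d2 * e)); last by rewrite mulrCA.
  rewrite (_ : e * (d1 * d2) = d1 * (d2 * e)); last by rewrite mulrC -mulrA.
  by rewrite [phi (d * _)]rmorphM [phi (d1 * _)]rmorphM !mulrA h1.
rewrite (_ : d1 * (d * e) = e * (d1 * d)); last by rewrite mulrA mulrC.
rewrite (_ : d * (d1 * d2) = d2 * (d1 * d)); last by rewrite mulrA mulrC [d * _]mulrC.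
by rewrite [phi (e * _)]rmorphM [phi (d2 * _)]rmorphM !mulrA h2.
Qed.

Lemma loc_oppE a d : d != 0 -> loc_opp (frac a d) = frac (- a) d.
Proof.
by move=> d0; apply/fracP; rewrite ?denom_neq0// !mulNr numer_frac.
Qed.

Lemma loc_mulE a d b e : d != 0 -> e != 0 ->
  loc_mul (frac a d) (frac b e) = frac (a * b) (d * e).
Proof.
move=> d0 e0; apply/fracP; rewrite ?mulf_neq0 ?denom_neq0//.
have := numer_frac b e0; have := numer_frac a d0.
set n1 := numer _; set d1 := denom _; set n2 := numer _; set d2 := denom _.
move=> h1 h2.
have -> : n1 * n2 * phi (d * e) = n1 * (n2 * phi e) * phi d.
  by rewrite [d * e]mulrC rmorphM !mulrA.
have -> : n1 * (n2 * phi e) * phi d = n1 * phi d * phi d2 * b.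
  by rewrite h2 -!mulrA -rmorphM -denom_comm [d2 * d]mulrC rmorphM !mulrA.
by rewrite h1 -!mulrA [phi d1 * _]mulrA -rmorphM denom_comm.
Qed.

Lemma frac_expand a d e : d != 0 -> e != 0 ->
  frac a d = frac (a * phi e) (d * e).
Proof.
move=> d0 e0; apply/fracP; rewrite ?mulf_neq0// rmorphM -mulrA.
by rewrite [phi e * _]denom_comm.
Qed.

Lemma loc_addEr a b d : d != 0 ->
  loc_add (frac a d) (frac b d) = frac (a + b) d.
Proof.
by move=> d0; rewrite loc_addE// -mulrDl -frac_expand.
Qed.

Lemma loc_common f g :
  exists a b d, [/\ d != 0, f = frac a d & g = frac b d].
Proof.
elim/locW: f => a d d0; elim/locW: g => b e e0.
exists (a * phi e), (b * phi d), (d * e); split; first by rewrite mulf_neq0.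
  exact: frac_expand.
by rewrite mulrC; apply: frac_expand.
Qed.

Lemma loc_addC : commutative loc_add.
Proof.
by move=> f g; have [a [b [d [d0 -> ->]]]] := loc_common f g; rewrite !loc_addEr// addrC.
Qed.
Lemma loc_addA : associative loc_add.
Proof.
move=> f g; have [a [b [d [d0 -> ->]]]] := loc_common f g.
elim/locW => c e e0.
rewrite (frac_expand a d0 e0) (frac_expand b d0 e0) (frac_expand c e0 d0).
by rewrite [e * d]mulrC !loc_addEr ?mulf_neq0// addrA.
Qed.
Lemma loc_add0 : left_id (frac 0 1) loc_add.
Proof.
elim/locW => a d d0.
by rewrite loc_addE ?oner_neq0// mul0r add0r rmorph1 mulr1 mul1r.
Qed.
Lemma loc_addN : left_inverse (frac 0 1) loc_opp loc_add.
Proof.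
elim/locW => a d d0; rewrite loc_oppE// loc_addEr// addNr.
by apply/fracP; rewrite ?oner_neq0// !mul0r.
Qed.
HB.instance Definition _ := GRing.isZmodule.Build loc
  loc_addA loc_addC loc_add0 loc_addN.

Lemma loc_mulA : associative loc_mul.
Proof.
elim/locW => a d d0; elim/locW => b e e0; elim/locW => c f f0.
by rewrite !loc_mulE ?mulf_neq0// !mulrA.
Qed.
Lemma loc_mul1 : left_id (frac 1 1) loc_mul.
Proof.
by elim/locW => a d d0; rewrite loc_mulE ?oner_neq0// !mul1r.
Qed.
Lemma loc_mul_1 : right_id (frac 1 1) loc_mul.
Proof.
by elim/locW => a d d0; rewrite loc_mulE ?oner_neq0// !mulr1.
Qed.
Lemma loc_mulDl : left_distributive loc_mul loc_add.
Proof.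
move=> f g; have [a [b [d [d0 -> ->]]]] := loc_common f g.
elim/locW => c e e0.
by rewrite loc_addEr// !loc_mulE// loc_addEr ?mulf_neq0// mulrDl.
Qed.
Lemma loc_mulDr : right_distributive loc_mul loc_add.
Proof.
move=> f g h; have [a [b [d [d0 -> ->]]]] := loc_common g h.
elim/locW: f => c e e0.
by rewrite loc_addEr// !loc_mulE// loc_addEr ?mulf_neq0// mulrDr.
Qed.
Lemma loc_1neq0 : frac 1 1 != 0.
Proof.
apply/eqP => /fracP; rewrite !oner_neq0 rmorph1 mulr1 mul0r.
by move/(_ isT isT)/eqP; rewrite oner_eq0.
Qed.
HB.instance Definition _ := GRing.Zmodule_isNzRing.Build loc
  loc_mulA loc_mul1 loc_mul_1 loc_mulDl loc_mulDr loc_1neq0.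
End Localization.

Section LocMap.
Variables (D D' : idomainType) (A A' : nzRingType).
Variables (phi : denominators D A) (phi' : denominators D' A').

(* a / d |-> alpha a / delta d *)
Definition loc_map (alpha : A -> A') (delta : D -> D') (f : loc phi) : loc phi' :=
  frac phi' (alpha (numer f)) (delta (denom f)).

Variables (alpha : {rmorphism A -> A'}) (delta : {rmorphism D -> D'}).
Hypothesis alpha_delta : forall d, alpha (phi d) = phi' (delta d).
Hypothesis delta_neq0 : forall d, d != 0 -> delta d != 0.

Lemma loc_map_frac a d : d != 0 ->
  loc_map alpha delta (frac phi a d) = frac phi' (alpha a) (delta d).
Proof.
move=> d0; apply/fracP; rewrite ?delta_neq0 ?denom_neq0//.
by rewrite -!alpha_delta -!rmorphM numer_frac.
Qed.

Lemma loc_map_zmod : zmod_morphism (loc_map alpha delta).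
Proof.
move=> f g; have [a [b [d [d0 -> ->]]]] := loc_common f g.
rewrite -[_ - _]/(loc_add _ (loc_opp _)) loc_oppE// loc_addEr//.
rewrite !loc_map_frac// -[RHS]/(loc_add _ (loc_opp _)) loc_oppE ?delta_neq0//.
by rewrite loc_addEr ?delta_neq0// rmorphB.
Qed.

Lemma loc_map_monoid : monoid_morphism (loc_map alpha delta).
Proof.
split; first by rewrite loc_map_frac ?oner_neq0// !rmorph1.
elim/locW => a d d0; elim/locW => b e e0.
rewrite -[frac _ _ _ * _]/(loc_mul _ _) loc_mulE//.
rewrite !loc_map_frac ?mulf_neq0// -[RHS]/(loc_mul _ _).
by rewrite loc_mulE ?delta_neq0// !rmorphM.
Qed.
End LocMap.

Section ScalarDenominators.
Variables (C : fieldType) (R : algType C).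

Lemma scalar_denom_comm (c : C) (x : R) : in_alg R c * x = x * in_alg R c.
Proof. by rewrite /= mulr_algl mulr_algr. Qed.

Lemma scalar_denom_reg (c : C) : c != 0 -> GRing.rreg (in_alg R c).
Proof. by move=> c0 x y /=; rewrite !mulr_algr => /(scalerI c0). Qed.

Definition scalar_denominators : denominators C R :=
  Denominators scalar_denom_comm scalar_denom_reg.
End ScalarDenominators.

Section PolyDenominators.
Variables (D : idomainType) (A : nzRingType) (phi : denominators D A).

Lemma poly_denom_comm (q : {poly D}) (p : {poly A}) :
  map_poly phi q * p = p * map_poly phi q.
Proof.
apply/polyP => k; rewrite coefM coefMr; apply: eq_bigr => i _.
by rewrite coef_map denom_comm.
Qed.

Lemma poly_denom_reg (q : {poly D}) : q != 0 -> GRing.rreg (map_poly phi q).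
Proof.
move=> q0; apply: rreg_lead.
have lq0 : lead_coef q != 0 by rewrite lead_coef_eq0.
have phi0 : phi (lead_coef q) != 0.
  apply/eqP => /(congr1 ( *%R 1)); rewrite mulr0 -(mul0r (phi (lead_coef q))).
  by move/(denom_reg lq0)/eqP; rewrite oner_eq0.
by rewrite lead_coef_map_id0 ?rmorph0//; apply: denom_reg.
Qed.

Definition poly_denominators : denominators {poly D} {poly A} :=
  Denominators poly_denom_comm poly_denom_reg.
End PolyDenominators.

(* R(z), the tensor product of R and C(z): fractions p / q, p in R[z], q in
   C[z] \ 0; and R(u, v), fractions with numerator in R[u][v], denominator in
   C[u][v] \ 0. *)
Notation ratfun R := (loc (poly_denominators (scalar_denominators R))).
Notation ratfun2 R :=
  (loc (poly_denominators (poly_denominators (scalar_denominators R)))).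

Section RatFun.
Variables (C : numFieldType) (R : algType C).

Definition poly_shift (a : C) (p : {poly R}) : {poly R} :=
  p \Po ('X + (a%:A)%:P).
Definition denom_shift (a : C) (q : {poly C}) : {poly C} :=
  q \Po ('X + a%:P).

Lemma poly_shift_zmod a : zmod_morphism (poly_shift a).
Proof. by move=> p q; apply: raddfB. Qed.
HB.instance Definition _ a := GRing.isZmodMorphism.Build {poly R} {poly R}
  (poly_shift a) (poly_shift_zmod a).

Lemma poly_shift_monoid a : monoid_morphism (poly_shift a).
Proof.
split=> [|p q]; first exact: comp_polyC.
rewrite /poly_shift /comp_poly rmorphM /= hornerM_comm// /comm_poly.
rewrite -/(comp_poly _ _) mulrDl mulrDr -commr_polyX; congr (_ + _).
apply/polyP => k; rewrite coefCM coefMC.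
by rewrite /= mulr_algl mulr_algr.
Qed.
HB.instance Definition _ a := GRing.isMonoidMorphism.Build {poly R} {poly R}
  (poly_shift a) (poly_shift_monoid a).
HB.instance Definition _ a := GRing.RMorphism.copy (denom_shift a)
  (comp_poly ('X + a%:P)).

Lemma denom_shift_neq0 a q : q != 0 -> denom_shift a q != 0.
Proof.
move=> q0; have s2 : size ('X + a%:P) = 2%N by rewrite size_XaddC.
by rewrite -size_poly_eq0 size_comp_poly2// size_poly_eq0.
Qed.

Lemma poly_shift_denom a (q : {poly C}) :
  poly_shift a (map_poly (in_alg R) q) = map_poly (in_alg R) (denom_shift a q).
Proof. by rewrite map_comp_poly rmorphD /= map_polyX map_polyC. Qed.

Definition ratfun_shift (a : C) : ratfun R -> ratfun R :=
  loc_map (poly_denominators (scalar_denominators R))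
    (poly_shift a) (denom_shift a).

Lemma ratfun_shiftB a : zmod_morphism (ratfun_shift a).
Proof.
apply: loc_map_zmod => [q|q]; last exact: denom_shift_neq0.
exact: poly_shift_denom.
Qed.
HB.instance Definition _ := hasShift.Build C (ratfun R) ratfun_shiftB.

Definition ev_u (f : ratfun R) : ratfun2 R :=
  loc_map (poly_denominators (poly_denominators (scalar_denominators R)))
    polyC polyC f.
Definition ev_v (f : ratfun R) : ratfun2 R :=
  loc_map (poly_denominators (poly_denominators (scalar_denominators R)))
    (map_poly polyC) (map_poly polyC) f.

(* 1 / (u - v); in {poly {poly C}} the inner variable is u, the outer one v. *)
Definition inv_uv : ratfun2 R := frac _ 1 (('X)%:P - 'X).

Lemma ev_u_comm (q : {poly C}) :
  (map_poly (in_alg R) q)%:P = map_poly (map_poly (in_alg R)) q%:P.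
Proof. by rewrite map_polyC. Qed.

Lemma ev_v_comm (q : {poly C}) :
  map_poly polyC (map_poly (in_alg R) q) =
  map_poly (map_poly (in_alg R)) (map_poly polyC q).
Proof. by apply/polyP => k; rewrite !coef_map /= map_polyC. Qed.

Lemma ev_u_frac p q : q != 0 -> ev_u (frac _ p q) = frac _ p%:P q%:P.
Proof.
move=> q0; apply: loc_map_frac => // [d|d]; last by rewrite polyC_eq0.
exact: ev_u_comm.
Qed.

Lemma ev_v_frac p q : q != 0 ->
  ev_v (frac _ p q) = frac _ (map_poly polyC p) (map_poly polyC q).
Proof.
move=> q0; apply: loc_map_frac => // [d|d]; last by rewrite map_polyC_eq0.
exact: ev_v_comm.
Qed.

Lemma uv_neq0 : ('X)%:P - 'X != 0 :> {poly {poly C}}.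
Proof. by rewrite -opprB oppr_eq0 polyXsubC_eq0. Qed.

Lemma inv_uvP : inv_uv * (ev_u (frac _ 'X 1) - ev_v (frac _ 'X 1)) = 1.
Proof.
rewrite ev_u_frac ?ev_v_frac ?oner_neq0// !rmorph1 map_polyX.
rewrite -[_ - _]/(loc_add _ (loc_opp _)) loc_oppE ?oner_neq0//.
rewrite loc_addEr ?oner_neq0// -[LHS]/(loc_mul _ _).
rewrite loc_mulE ?uv_neq0 ?oner_neq0// mul1r mulr1.
apply/fracP; rewrite ?uv_neq0 ?oner_neq0// rmorph1 mulr1 mul1r.
by rewrite /= rmorphB /= map_polyX map_polyC /= map_polyX.
Qed.

Definition ratfun_yangian n (T : 'M[ratfun R]_n) : Prop :=
  forall i j k l,
    lie (ev_u (T i j)) (ev_v (T k l)) =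
    inv_uv * (ev_u (T k j) * ev_v (T i l) - ev_v (T k j) * ev_u (T i l)).

End RatFun.

(* Main.v *)
(* Both Manin properties follow from the defining relation at u - v = 1, where
   the pole 1/(u - v) disappears: at (u, v) = (z, z - 1) for T(z) e^{-d/dz}, and
   at (z + 1, z), its shift, for the other matrix.  The substitution v = z - 1 is
   only possible after multiplying by u - v.  For rational functions one also
   clears denominators, and substitutes in R[u][v].  For Laurent series one
   applies the functional u^p v^q |-> [z^m] z^p (z - 1)^q, which does not see
   the factor u - v.  That shifts are ring morphisms of R((z^-1)) is the
   Chu-Vandermonde identity for the coefficients of (z + a)^k. *)

Require Import Defs.
From mathcomp Require Import all_boot all_order all_algebra reals.
From mathcomp.real_closed Require Import complex.
From mathcomp Require Import boolp classical_sets functions cardinality fsbigop.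
From mathcomp Require Import ring zify.
Import Order.TTheory GRing.Theory Num.Theory.
(* Re-imported so that [frac] is the localization of Defs, not that of [fraction]. *)
Import Defs.
Local Open Scope ring_scope.

Set Implicit Arguments.
Unset Strict Implicit.
Unset Printing Implicit Defensive.

(** * Manin matrices from the relation at u - v = 1 *)

(** Two instances of the specialised relation contain the same products [p] and [q], those with the
    shifted factor on the left; eliminating them leaves an equality of two commutators. *)
Lemma subr_exchange (V : zmodType) (p q a b c d : V) :
  a - p = c - q -> d - q = b - p -> a - b = c - d.
Proof.
move=> E1 E2; rewrite -[LHS](addrKA (- p)) E1 [- p + b]addrC -E2.
by rewrite [d - q]addrC addrKA.
Qed.

Section AbstractManin.
Variables (C : numFieldType) (F : shiftRingType C).
Hypothesis shiftM : forall (a : C) (f g : F), shift a (f * g) = shift a f * shift a g.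
Hypothesis shiftD : forall (a b : C) (f : F), shift a (shift b f) = shift (a + b) f.
Hypothesis shift0 : forall f : F, shift (0 : C) f = f.

Lemma shiftop_mulop (a : C) (f : F) :
  shiftop F a * mulop f = mulop (shift a f) * shiftop F a.
Proof. by apply: endoP => x; rewrite !endoME /= shiftM. Qed.

(** Moving both shifts to the right leaves the common factor [shiftop F a * shiftop F a], so the
    Manin conditions become identities in [F]. *)
Lemma lie_mulop_shiftop (a : C) (f g : F) :
  lie (mulop f * shiftop F a) (mulop g * shiftop F a) =
  mulop (f * shift a g - g * shift a f) * (shiftop F a * shiftop F a).
Proof.
apply: endoP => x; rewrite /lie !endoDE !endoNE !endoME /= !shiftM !mulrA.
by rewrite mulrBl.
Qed.

Lemma mulop0 : mulop (0 : F) = 0.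
Proof. by apply: endoP => x /=; rewrite mul0r. Qed.

Variables (n : nat) (T : 'M[F]_n).

(** A single identity for both displayed equalities, at a = -1 and at a = 1. *)
Lemma mx_shiftop_shift (a c : C) :
  mx_shiftop (map_mx (shift c) T) a = shiftop_mx a (map_mx (shift (c - a)) T).
Proof.
by apply/matrixP => i j; rewrite !mxE shiftop_mulop shiftD addrC subrK.
Qed.

(* The relation of Yangian type at u = z, v = z - 1. *)
Hypothesis T_spec : forall i j k l,
  T i j * shift (-1 : C) (T k l) - shift (-1 : C) (T k l) * T i j =
  T k j * shift (-1 : C) (T i l) - shift (-1 : C) (T k j) * T i l.

Lemma manin_mx_shiftop : manin (mx_shiftop T (-1 : C)).
Proof.
split=> [i k j|i j k l]; rewrite !mxE !lie_mulop_shiftop.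
  (* For l = j both sides subtract the same product, and what remains is T_ij(z) T_kj(z - 1) =
     T_kj(z) T_ij(z - 1). *)
  by have/addIr -> := T_spec i j k j; rewrite subrr mulop0 mul0r.
by congr (mulop _ * _); apply: subr_exchange (T_spec i j k l) (T_spec i l k j).
Qed.

Lemma manin_shiftop_mx : manin (shiftop_mx (1 : C) T)^T.
Proof.
have T_spec1 i j k l :
    shift (1 : C) (T i j) * T k l - T k l * shift (1 : C) (T i j) =
    shift (1 : C) (T k j) * T i l - T k j * shift (1 : C) (T i l).
  have /(congr1 (shift (1 : C))) := T_spec i j k l.
  by rewrite !shiftB !shiftM !shiftD !subrr !shift0.
split=> [i k j|i j k l]; rewrite !mxE !shiftop_mulop lie_mulop_shiftop.
  (* Transposition turns columns into rows: for equal row indices the first products on the two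
     sides of [T_spec1] coincide and cancel. *)
  have/addrI/oppr_inj := T_spec1 j k j i; rewrite -!shiftM => ->.
  by rewrite subrr mulop0 mul0r.
rewrite lie_mulop_shiftop -!shiftM -!shiftB; congr (mulop (shift _ _) * _).
apply: subr_exchange; apply: oppr_inj; rewrite !opprB.
  exact: T_spec1 l k j i.
exact: T_spec1 j k l i.
Qed.
End AbstractManin.

(** Isolates what series and rational functions must each supply: shifts act by ring morphisms and
    compose additively, the Lax relation [Y] specialises at v = z - 1, and [Y] is stable under
    shifts. *)
Lemma yangian_manin (C : numFieldType) (F : shiftRingType C) n
    (Y : 'M[F]_n -> Prop) :
    (forall (a : C) (f g : F), shift a (f * g) = shift a f * shift a g) ->
    (forall (a b : C) (f : F), shift a (shift b f) = shift (a + b) f) ->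
    (forall f : F, shift (0 : C) f = f) ->
    (forall T, Y T -> forall i j k l,
      T i j * shift (-1 : C) (T k l) - shift (-1 : C) (T k l) * T i j =
      T k j * shift (-1 : C) (T i l) - shift (-1 : C) (T k j) * T i l) ->
    (forall (c : C) T, Y T -> Y (map_mx (shift c) T)) ->
  forall T, Y T ->
    [/\ manin (mx_shiftop T (-1 : C)), manin (shiftop_mx (1 : C) T)^T &
        forall c : C,
          [/\ Y (map_mx (shift c) T),
              mx_shiftop (map_mx (shift c) T) (-1) =
                shiftop_mx (-1) (map_mx (shift (c + 1)) T),
              manin (mx_shiftop (map_mx (shift c) T) (-1 : C)),
              (shiftop_mx 1 (map_mx (shift c) T))^T =
                (mx_shiftop (map_mx (shift (c + 1)) T) 1)^T &
              manin (shiftop_mx (1 : C) (map_mx (shift c) T))^T]].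
Proof.
move=> sM sD s0 Yspec Yshift T YT.
split; [exact: manin_mx_shiftop (Yspec _ YT)|exact: manin_shiftop_mx (Yspec _ YT)|].
move=> c; have YcT := Yshift c T YT.
split=> //; first by rewrite mx_shiftop_shift // opprK.
- exact: manin_mx_shiftop (Yspec _ YcT).
(* Applied on the right-hand side, at c + 1, where (c + 1) - 1 = c. *)
- by rewrite mx_shiftop_shift // addrK.
- exact: manin_shiftop_mx (Yspec _ YcT).
Qed.

(** * Rational functions *)

Section LocFrac.
Variables (D : idomainType) (A : nzRingType) (phi : denominators D A).

Lemma fracM a b d e : d != 0 -> e != 0 ->
  frac phi a d * frac phi b e = frac phi (a * b) (d * e).
Proof. exact: loc_mulE. Qed.

Lemma fracB a b d : d != 0 -> frac phi a d - frac phi b d = frac phi (a - b) d.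
Proof.
by move=> d0; rewrite -[LHS]/(loc_add _ (loc_opp _)) loc_oppE ?loc_addEr.
Qed.

Lemma loc_common_seq (s : seq (loc phi)) :
  exists2 d, d != 0 & forall f, f \in s -> exists a, f = frac phi a d.
Proof.
elim: s => [|f s [d d0 IHs]]; first by exists 1; rewrite ?oner_neq0.
exists (d * denom f) => [|g]; first by rewrite mulf_neq0 ?denom_neq0.
rewrite inE => /predU1P[->|/IHs[a ->]]; last first.
  by exists (a * phi (denom f)); rewrite -frac_expand ?denom_neq0.
exists (numer f * phi d).
by rewrite mulrC -frac_expand ?frac_numer_denom ?denom_neq0.
Qed.

(** Denominators are central and regular, so clearing them is reversible. *)
Lemma frac_cancel a b d e : d != 0 -> e != 0 ->
  frac phi a d = frac phi b (e * d) <-> phi e * a = b.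
Proof.
move=> d0 e0; rewrite fracP ?mulf_neq0 // rmorphM mulrA -[a * _]denom_comm.
by split=> [/(denom_reg d0)|->].
Qed.
End LocFrac.

(** * Shifts and the Lax relation over R(z) *)

Section RatfunYangian.
Variables (C : numFieldType) (R : algType C).
Local Notation frac1 := (frac (poly_denominators (scalar_denominators R))).
Implicit Types (a b : C) (p q : {poly R}) (d e : {poly C}).

Lemma ratfun_shift_frac a p d :
  d != 0 -> shift a (frac1 p d : ratfun R) = frac1 (poly_shift a p) (denom_shift a d).
Proof.
move=> d0; apply: loc_map_frac => // [q|q]; last exact: denom_shift_neq0.
exact: poly_shift_denom.
Qed.

Lemma ratfun_shiftM a (f g : ratfun R) : shift a (f * g) = shift a f * shift a g.
Proof.
elim/locW: f => p d d0; elim/locW: g => q e e0.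
by rewrite !(fracM, ratfun_shift_frac) ?mulf_neq0 ?denom_shift_neq0 // !rmorphM.
Qed.

Lemma denom_shiftD a b d : denom_shift a (denom_shift b d) = denom_shift (a + b) d.
Proof.
rewrite /denom_shift -comp_polyA comp_polyD comp_polyX comp_polyC.
by rewrite -addrA -polyCD.
Qed.

(** Shifts are ring morphisms even for noncommutative [R], so an induction reduces the claim to ['X]
    and constants. *)
Lemma poly_shiftD a b p : poly_shift a (poly_shift b p) = poly_shift (a + b) p.
Proof.
elim/poly_ind: p => [|p c IHp]; first by rewrite !rmorph0.
have X_shift u : poly_shift u 'X = 'X + (u%:A)%:P :> {poly R}.
  by rewrite /poly_shift comp_polyX.
have C_shift u (x : R) : poly_shift u x%:P = x%:P by exact: comp_polyC.
rewrite !(rmorphD, rmorphM) /= IHp !C_shift !X_shift rmorphD /= C_shift X_shift.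
by rewrite scalerDl polyCD addrA.
Qed.

Lemma ratfun_shiftD a b (f : ratfun R) : shift a (shift b f) = shift (a + b) f.
Proof.
elim/locW: f => p d d0.
by rewrite !ratfun_shift_frac ?denom_shift_neq0 // poly_shiftD denom_shiftD.
Qed.

Lemma ratfun_shift0 (f : ratfun R) : shift (0 : C) f = f.
Proof.
elim/locW: f => p d d0; rewrite ratfun_shift_frac // /poly_shift /denom_shift.
by rewrite scale0r !addr0 !comp_polyXr.
Qed.

(** With one denominator d for all entries, every product is a fraction over d(u) d(v), which
    cancels together with u - v. The forward direction allows substitution in R[u][v]; the backward
    one returns to R(u, v) after a shift. *)
Lemma ratfun_yangian_polyP (p1 p2 p3 p4 : {poly R}) d : d != 0 ->
  let f1 : ratfun R := frac1 p1 d in let f2 : ratfun R := frac1 p2 d in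
  let f3 : ratfun R := frac1 p3 d in let f4 : ratfun R := frac1 p4 d in
  lie (ev_u f1) (ev_v f2) = inv_uv R * (ev_u f3 * ev_v f4 - ev_v f3 * ev_u f4) <->
  ('X%:P - 'X) * lie p1%:P (map_poly polyC p2) =
    p3%:P * map_poly polyC p4 - map_poly polyC p3 * p4%:P :> {poly {poly R}}.
Proof.
move=> d0 f1 f2 f3 f4.
have dv0 : map_poly polyC d != 0 by rewrite map_polyC_eq0.
have du0 : d%:P != 0 by rewrite polyC_eq0.
have duv0 : d%:P * map_poly polyC d != 0 by rewrite mulf_neq0.
rewrite /lie !ev_u_frac ?ev_v_frac // !(fracM _ _ _ du0 dv0) !(fracM _ _ _ dv0 du0).
rewrite [d^:P * _]mulrC !fracB // fracM ?uv_neq0 // mul1r.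
have := frac_cancel (poly_denominators (poly_denominators (scalar_denominators R)))
  (p1%:P * map_poly polyC p2 - map_poly polyC p2 * p1%:P)
  (p3%:P * map_poly polyC p4 - map_poly polyC p3 * p4%:P)
  duv0 (uv_neq0 C).
by rewrite /= rmorphB /= map_polyC map_polyX /= map_polyX.
Qed.

(** Evaluation over a noncommutative ring is multiplicative at a central point; the points used
    below, a variable plus a scalar, are central. *)
Lemma comp_polyM_comm (A : nzRingType) (p q c : {poly A}) :
  (forall x, GRing.comm x c) -> (p * q) \Po c = (p \Po c) * (q \Po c).
Proof. by move=> cC; rewrite /comp_poly rmorphM hornerM_comm //; apply/esym/cC. Qed.

Lemma polyC_comm (A : nzRingType) (c : A) :
  (forall x, GRing.comm x c) -> forall p : {poly A}, GRing.comm p c%:P.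
Proof. by move=> cC p; apply/polyP => k; rewrite coefCM coefMC cC. Qed.

Lemma polyXaddC_comm (A : nzRingType) (c : A) :
  (forall x, GRing.comm x c) -> forall p : {poly A}, GRing.comm p ('X + c%:P).
Proof.
by move=> cC p; rewrite /GRing.comm mulrDl mulrDr commr_polyX polyC_comm.
Qed.

Lemma scalar_comm a (x : R) : GRing.comm x a%:A.
Proof. by rewrite /GRing.comm mulr_algl mulr_algr. Qed.

Lemma ratfun_yangian_common n (T : 'M[ratfun R]_n) :
  exists (d : {poly C}) (P : 'M[{poly R}]_n), d != 0 /\
    forall i j, T i j = frac1 (P i j) d.
Proof.
have [d d0 dP] := @loc_common_seq _ _ _ [seq T ij.1 ij.2 | ij : 'I_n * 'I_n].
have TP i j : exists p, T i j == frac1 p d.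
  have [|p ->] := dP (T i j); last by exists p.
  exact: (codom_f (fun ij : 'I_n * 'I_n => T ij.1 ij.2) (i, j)).
exists d, (\matrix_(i, j) xchoose (TP i j)); split=> // i j.
by rewrite mxE; apply/eqP/(xchooseP (TP i j)).
Qed.

Lemma ratfun_yangian_spec n (T : 'M[ratfun R]_n) : ratfun_yangian T ->
  forall i j k l,
  T i j * shift (-1 : C) (T k l) - shift (-1 : C) (T k l) * T i j =
  T k j * shift (-1 : C) (T i l) - shift (-1 : C) (T k j) * T i l.
Proof.
have [d [P [d0 TE]]] := ratfun_yangian_common T.
move=> Ty i j k l; have := Ty i j k l; rewrite !TE => /(ratfun_yangian_polyP _ _ _ _ d0).
(* The value z - 1 for the outer variable v; the inner variable u becomes z. *)
pose Q : {poly R} := 'X + ((-1)%:A)%:P.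
rewrite !(ratfun_shift_frac _ _ d0).
move=> /(congr1 (fun p : {poly {poly R}} => p.[Q])).
have sd0 := denom_shift_neq0 (-1) d0.
rewrite !(fracM _ _ _ d0 sd0) !(fracM _ _ _ sd0 d0).
rewrite [denom_shift _ _ * _]mulrC !fracB ?mulf_neq0 //.
have hM (p q : {poly {poly R}}) : (p * q).[Q] = p.[Q] * q.[Q].
  by rewrite hornerM_comm //; apply/esym/polyXaddC_comm/scalar_comm.
rewrite /lie !(hM, hornerD, hornerN, hornerC, hornerX).
(* The factor u - v takes the value z - (z - 1) = 1. *)
rewrite {1}/Q scaleN1r polyCN opprB addrC subrK mul1r.
by move=> E; congr frac.
Qed.

Lemma ratfun_yangian_shift c n (T : 'M[ratfun R]_n) :
  ratfun_yangian T -> ratfun_yangian (map_mx (shift c) T).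
Proof.
have [d [P [d0 TE]]] := ratfun_yangian_common T.
move=> Ty i j k l; have := Ty i j k l; rewrite !mxE !TE.
rewrite !(ratfun_shift_frac _ _ d0) => /(ratfun_yangian_polyP _ _ _ _ d0) E.
apply/ratfun_yangian_polyP; first exact: denom_shift_neq0.
pose Q := 'X + (c%:A)%:P : {poly R}.
(* The simultaneous shift: [poly_shift c] acts on the inner variable u, and composition with
   [map_poly polyC Q], which is v + c, on the outer one. It is multiplicative and fixes u - v. *)
pose S (p : {poly {poly R}}) : {poly {poly R}} :=
  map_poly (poly_shift c) p \Po map_poly polyC Q.
have SB x y : S (x - y) = S x - S y by rewrite /S rmorphB comp_polyB.
have SM x y : S (x * y) = S x * S y.
  rewrite /S rmorphM comp_polyM_comm // => z.
  rewrite rmorphD /= map_polyX map_polyC.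
  exact/polyXaddC_comm/polyC_comm/scalar_comm.
have Su (p : {poly R}) : S p%:P = (poly_shift c p)%:P.
  by rewrite /S map_polyC comp_polyC.
have Sv (p : {poly R}) : S (map_poly polyC p) = map_poly polyC (poly_shift c p).
  rewrite /S -map_poly_comp (eq_map_poly (g := polyC)) -?map_comp_poly //.
  by move=> x; apply: comp_polyC.
have SX : S ('X%:P - 'X) = 'X%:P - 'X.
  rewrite SB Su -[X in S X](map_polyX polyC) Sv.
  rewrite /poly_shift !comp_polyX [X in _ - X]rmorphD /= map_polyX map_polyC.
  by rewrite polyCD [X in _ - X]addrC addrKA.
have /(congr1 S) := E.
by rewrite /lie !(SM, SB, SX, Su, Sv).
Qed.
End RatfunYangian.

(** * Laurent series *)

Section IntSums.
Variable V : zmodType.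
Implicit Types (F G : int -> V) (H : int -> int -> V).

(** A sum with infinite support has the default value 0, whence the conditions [finsupp] and
    [finsupp2]. *)
Definition zsum F : V := \sum_(i \in [set: int]) F i.

Definition finsupp F := exists B : int, forall i, ~~ (- B <= i <= B) -> F i = 0.
Definition finsupp2 H := exists B : int,
  forall i j, ~~ ((- B <= i <= B) && (- B <= j <= B)) -> H i j = 0.

Definition zrange (B : int) := [seq i%:Z - B | i <- iota 0 (`|B| + `|B|).+1].

Lemma zsumE F B : 0 <= B -> (forall i, ~~ (- B <= i <= B) -> F i = 0) ->
  zsum F = \sum_(i <- zrange B) F i.
Proof.
move=> B0 FB; have r_uniq : uniq (zrange B).
  by rewrite map_inj_uniq ?iota_uniq// => i j; lia.
rewrite /zsum (fsbigE (zrange B)) //.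
  by rewrite (eq_bigl xpredT) => // i; rewrite in_setT.
move=> i _ ir; apply: FB; apply: contra ir => iB.
by apply/mapP; exists (absz (i + B)%R); rewrite ?mem_iota; lia.
Qed.

Lemma finsuppI F (L U : int) :
  (forall i, i < L -> F i = 0) -> (forall i, U < i -> F i = 0) -> finsupp F.
Proof.
move=> FL FU; exists (`|L| + `|U|) => i.
have [/FL //|Li] := ltP i L; have [/FU //|iU] := ltP U i.
by lia.
Qed.

Lemma finsupp2I H (L U L' U' : int) :
    (forall i j, i < L -> H i j = 0) -> (forall i j, U < i -> H i j = 0) ->
    (forall i j, j < L' -> H i j = 0) -> (forall i j, U' < j -> H i j = 0) ->
  finsupp2 H.
Proof.
move=> HL HU HL' HU'; exists (`|L| + `|U| + `|L'| + `|U'|) => i j.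
have [/HL //|Li] := ltP i L; have [/HU //|iU] := ltP U i.
have [/HL' //|Lj] := ltP j L'; have [/HU' //|jU] := ltP U' j.
by lia.
Qed.

Lemma eq_zsum F G : F =1 G -> zsum F = zsum G.
Proof. by move=> /funext ->. Qed.

(** The support lies in a square box, where both sides are finite double sums. *)
Lemma zsum_exchange H : finsupp2 H ->
  zsum (fun i => zsum (H i)) = zsum (fun j => zsum (H^~ j)).
Proof.
case=> B HB; pose B' : int := `|B|.
have HB' i j : ~~ ((- B' <= i <= B') && (- B' <= j <= B')) -> H i j = 0.
  by move=> ij; apply: HB; lia.
have B0 : 0 <= B' by rewrite /B'; lia.
have rowE i : zsum (H i) = \sum_(j <- zrange B') H i j.
  by apply: zsumE => // j jB; apply: HB'; rewrite (negPf jB) andbF.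
have colE j : zsum (H^~ j) = \sum_(i <- zrange B') H i j.
  by apply: zsumE => // i iB; apply: HB'; rewrite (negPf iB).
rewrite (eq_zsum rowE) (eq_zsum colE) (zsumE B0) => [|i iB]; last first.
  by apply: big1 => j _; apply: HB'; rewrite (negPf iB).
rewrite (zsumE B0) => [|j jB]; first exact: exchange_big.
by apply: big1 => i _; apply: HB'; rewrite (negPf jB) andbF.
Qed.

Lemma zsumB F G : finsupp F -> finsupp G ->
  zsum (fun i => F i - G i) = zsum F - zsum G.
Proof.
case=> [B FB] [B' GB']; pose M : int := `|B| + `|B'|.
have M0 : 0 <= M by rewrite /M; lia.
have FM i : ~~ (- M <= i <= M) -> F i = 0 by move=> iM; apply: FB; lia.
have GM i : ~~ (- M <= i <= M) -> G i = 0 by move=> iM; apply: GB'; lia.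
rewrite (zsumE M0 FM) (zsumE M0 GM) -sumrB; apply: (zsumE M0) => i iM.
by rewrite FM // GM // subr0.
Qed.

Lemma zsum2B H H' : finsupp2 H -> finsupp2 H' ->
  zsum (fun i => zsum (fun j => H i j - H' i j)) =
  zsum (fun i => zsum (H i)) - zsum (fun i => zsum (H' i)).
Proof.
case=> [B FB] [B' GB']; rewrite -zsumB.
- apply: eq_zsum => i; rewrite zsumB //; [exists B|exists B'] => j jB.
  + by apply: FB; rewrite (negPf jB) andbF.
  + by apply: GB'; rewrite (negPf jB) andbF.
- exists B => i iB; apply: fsbig1 => j _; apply: FB; by rewrite (negPf iB).
- exists B' => i iB; apply: fsbig1 => j _; apply: GB'; by rewrite (negPf iB).
Qed.

Lemma zsum_shift F (c : int) : zsum (fun i => F (i + c)) = zsum F.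
Proof.
apply/esym/reindex_fsbigT; exists (fun i => i - c) => i; first exact: addrK.
exact: subrK.
Qed.

Lemma zsum_opp F (c : int) : zsum (fun i => F (c - i)) = zsum F.
Proof. by apply/esym/reindex_fsbigT; exists (fun i => c - i) => i; rewrite subKr. Qed.

Lemma zsum_nat F n : (forall i, i < 0 -> F i = 0) ->
  (forall i, n%:Z <= i -> F i = 0) -> zsum F = \sum_(i < n) F i%:Z.
Proof.
move=> F0 Fn; pose s := [seq i%:Z | i <- iota 0 n].
have s_uniq : uniq s by rewrite map_inj_uniq ?iota_uniq// => i j; lia.
rewrite /zsum (fsbigE s) //.
  rewrite (eq_bigl xpredT) => [|i]; last by rewrite in_setT.
  by rewrite big_map -{1}(subn0 n) (big_mkord xpredT (fun i => F i%:Z)).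
move=> i _ ins; have [/F0 //|i0] := ltP i 0; have [/Fn //|ltn] := leP n%:Z i.
by case/negP: ins; apply/mapP; exists (absz i); rewrite ?mem_iota; lia.
Qed.
End IntSums.

Lemma zsum_map (U V : zmodType) (phi : U -> V) F :
  zmod_morphism phi -> finsupp F -> phi (zsum F) = zsum (fun i => phi (F i)).
Proof.
move=> phiB [B FB]; pose B' : int := `|B|.
have phi0 : phi 0 = 0 by rewrite -(subrr 0) phiB subrr.
have phiD x y : phi (x + y) = phi x + phi y.
  by rewrite -[y in LHS]opprK phiB -[- y]sub0r phiB phi0 sub0r opprK.
have FB' i : ~~ (- B' <= i <= B') -> F i = 0 by move=> iB; apply: FB; lia.
have B0 : 0 <= B' by rewrite /B'; lia.
rewrite !(zsumE B0) //; last by move=> i /FB' ->.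
exact: (big_morph phi phiD phi0).
Qed.

(** * Coefficients of (z + a)^k and Vandermonde identities *)

Section Kernel.
Variable C : numFieldType.
Implicit Types (a b : C) (k m : int).

(** The falling factorial. *)
Definition ffact (x : C) n : C := \prod_(i < n) (x - i%:R).

Lemma ffactD x (m n : nat) : ffact x (m + n) = ffact x m * ffact (x - m%:R) n.
Proof.
rewrite /ffact big_split_ord; congr (_ * _); apply: eq_bigr => i _.
by rewrite /= natrD opprD addrA.
Qed.

Lemma ffactS x n : ffact x n.+1 = ffact x n * (x - n%:R).
Proof. by rewrite /ffact big_ord_recr. Qed.

(** Induction on n: the new factor x + y - n splits as (x - i) + (y - (n - i)), and Pascal's rule
    recombines the two sums. *)
Lemma ffact_vandermonde x y n : ffact (x + y) n =
  \sum_(i < n.+1) (ffact x i * ffact y (n - i)) *+ 'C(n, i).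
Proof.
elim: n => [|n IHn]; first by rewrite big_ord1 /ffact !big_ord0 mulr1.
transitivity (\sum_(i < n.+1) (ffact x i.+1 * ffact y (n - i)) *+ 'C(n, i) +
              \sum_(i < n.+1) (ffact x i * ffact y (n - i).+1) *+ 'C(n, i)).
  rewrite ffactS IHn mulr_suml -big_split; apply: eq_bigr => i _ /=.
  rewrite !ffactS -mulrnDl mulrnAl; congr (_ *+ _).
  have -> : n%:R = i%:R + (n - i)%:R :> C by rewrite -natrD subnKC // -ltnS.
  by ring.
rewrite [RHS]big_ord_recl.
under [in RHS]eq_bigr => i _ do rewrite binS mulrnDr.
rewrite big_split /= addrA addrC; congr (_ + _).
rewrite big_ord_recl [in RHS]big_ord_recr /= (@bin_small n n.+1) // mulr0n addr0.
congr (_ + _); first by rewrite !subn0 !bin0.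
by apply: eq_bigr => i _; rewrite subnSK.
Qed.

Lemma binzE k n : binz C k n = ffact k%:~R n / n`!%:R.
Proof. by []. Qed.

Lemma binz_vandermonde (i j : int) (n : nat) :
  binz C (i + j) n = \sum_(x < n.+1) binz C i x * binz C j (n - x).
Proof.
have fact0 (m : nat) : m`!%:R != 0 :> C by rewrite pnatr_eq0 -lt0n fact_gt0.
rewrite binzE intrD ffact_vandermonde mulr_suml; apply: eq_bigr => x _.
have xn : (x <= n)%N by rewrite -ltnS.
rewrite !binzE -(bin_fact xn) !natrM -mulr_natr.
have : 'C(n, x)%:R != 0 :> C by rewrite pnatr_eq0 -lt0n bin_gt0.
by move=> ?; field; rewrite !fact0.
Qed.

(** The falling factorial of length i + j splits after its first i factors. *)
Lemma binz_comp k (i j : nat) :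
  binz C k i * binz C (k - i%:Z) j = binz C k (i + j) *+ 'C(i + j, i).
Proof.
have fact0 (m : nat) : m`!%:R != 0 :> C by rewrite pnatr_eq0 -lt0n fact_gt0.
rewrite !binzE ffactD -(bin_fact (leq_addr j i)) addKn.
rewrite -mulr_natr !natrM intrB.
have : 'C(i + j, i)%:R != 0 :> C by rewrite pnatr_eq0 -lt0n bin_gt0 leq_addr.
by move=> ?; field; rewrite !fact0.
Qed.

Lemma binz0 k : binz C k 0 = 1.
Proof. by rewrite /binz big_ord0 mul1r invr1. Qed.

(* The coefficient of z^m in (z + a)^k, expanded in z^-1. *)
Definition kern a k m : C :=
  if m <= k then binz C k (absz (k - m)) * a ^+ absz (k - m) else 0.

Lemma kern_gt a k m : k < m -> kern a k m = 0.
Proof. by rewrite /kern leNgt => ->. Qed.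

Lemma kernE a k n : kern a k (k - n%:Z) = binz C k n * a ^+ n.
Proof. by rewrite /kern ifT; [congr (binz C k _ * a ^+ _)|]; lia. Qed.

Lemma kern0 k m : kern 0 k m = (k == m)%:R.
Proof.
rewrite /kern expr0n; have [->|km] := eqVneq k m.
  by rewrite lexx subrr binz0 mulr1.
by case: ifP => // mk; rewrite (_ : (_ == 0)%N = false) ?mulr0 //; lia.
Qed.

(** Comparison of coefficients in (z + a)^(i + j) = (z + a)^i (z + a)^j. *)
Lemma kern_mul a (i j : int) m :
  kern a (i + j) m = zsum (fun p => kern a i p * kern a j (m - p)).
Proof.
have [ltm|lem] := ltP (i + j) m.
  rewrite kern_gt // [RHS]fsbig1 // => p _; have [lt|le] := ltP i p.
    by rewrite kern_gt ?mul0r.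
  by rewrite [X in _ * X]kern_gt ?mulr0 //; lia.
have [n ->] : exists n : nat, m = i + j - n%:Z by exists (absz (i + j - m)%R); lia.
(* The new index is i - p, the drop in degree in the first factor; it runs from 0 to n. *)
rewrite kernE -(zsum_opp _ i) (@zsum_nat _ _ n.+1); first last.
- by move=> x nx; rewrite [X in _ * X]kern_gt ?mulr0 //; lia.
- by move=> x x0; rewrite kern_gt ?mul0r //; lia.
rewrite binz_vandermonde mulr_suml; apply: eq_bigr => x _.
have xn : (x <= n)%N by rewrite -ltnS.
have -> : i + j - n%:Z - (i - x%:Z) = j - (n - x)%N%:Z by lia.
by rewrite !kernE [RHS]mulrACA -exprD subnKC.
Qed.

(** Expands ((z + a) + b)^l in powers of z + a, then each of these in powers of z; the binomial
    theorem for (a + b)^n matches the terms. *)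
Lemma kern_comp a b l m :
  kern (a + b) l m = zsum (fun k => kern a k m * kern b l k).
Proof.
have [ltm|lem] := ltP l m.
  rewrite kern_gt // [RHS]fsbig1 // => p _; have [lt|le] := ltP p m.
    by rewrite kern_gt ?mul0r.
  by rewrite [X in _ * X]kern_gt ?mulr0 //; lia.
have [n ->] : exists n : nat, m = l - n%:Z by exists (absz (l - m)%R); lia.
rewrite kernE -(zsum_opp _ l) (@zsum_nat _ _ n.+1); first last.
- by move=> x nx; rewrite kern_gt ?mul0r //; lia.
- by move=> x x0; rewrite [X in _ * X]kern_gt ?mulr0 //; lia.
rewrite exprDn mulr_sumr; apply: eq_bigr => x _.
have xn : (x <= n)%N by rewrite -ltnS.
have -> : l - n%:Z = l - x%:Z - (n - x)%N%:Z by lia.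
rewrite !kernE [RHS]mulrACA [binz _ _ _ * binz _ _ _]mulrC binz_comp subnKC //.
by rewrite mulrnAl mulrnAr.
Qed.

Lemma kern1 a m : kern a 1 m = (m == 1)%:R + a * (m == 0)%:R.
Proof.
have [m1|m1] := ltP 1 m.
  rewrite kern_gt //; have -> : m == 1 = false by lia.
  have -> : m == 0 = false by lia.
  by rewrite !mulr0n mulr0 addr0.
have [n ->] : exists n : nat, m = 1 - n%:Z by exists (absz (1 - m)%R); lia.
rewrite kernE; case: n {m m1} => [|[|n]].
- by rewrite subr0 binz0 mulr0 addr0 mulr1.
- by rewrite subrr /binz big_ord1 subr0 divr1 add0r mulrC.
(* From length 2 on, the falling factorial of 1 contains the factor 1 - 1. *)
rewrite binzE -[X in ffact _ X]/(2 + n)%N ffactD !ffactS subrr mulr0 !mul0r.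
have -> : 1 - n.+2%:Z == 1 = false by lia.
have -> : 1 - n.+2%:Z == 0 = false by lia.
by rewrite !mulr0n mulr0 addr0.
Qed.

(** Multiplication of (z + a)^k by z + a. This recursion governs how the functionals below treat the
    factor u - v. *)
Lemma kernS a k m : kern a (k + 1) m = kern a k (m - 1) + a * kern a k m.
Proof.
rewrite addrC kern_mul (@zsum_nat _ _ 2) => [|p p0|p p2].
- rewrite big_ord_recr big_ord1 /= !kern1 (subr0 m) mulr1 mulr0 add0r addr0.
  by rewrite mul1r addrC.
- rewrite kern1; have -> : p == 1 = false by lia.
  have -> : p == 0 = false by lia.
  by rewrite !mulr0n mulr0 addr0 mul0r.
- by rewrite kern_gt ?mul0r //; lia.
Qed.
End Kernel.

(** * Shifts on R((z^-1)) *)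

Section LaurentShiftTheory.
Variables (C : numFieldType) (R : algType C).
Implicit Types (a b : C) (f g : laurent R) (h : int -> int -> R).

(** Indexing by the exponent of [f] reduces the laws of shifts to identities between kernels. *)
Lemma laurent_shiftE a f m :
  shift a f m = zsum (fun k => kern a k m *: f k).
Proof.
have [N fN] := laurent_bound f.
have [K ltK] : exists K : nat, N < m + K%:Z by exists (absz (N - m)%R).+1; lia.
rewrite -[LHS]/(shift_coef a f m) (shift_coefE a fN ltK) -(zsum_shift _ m).
rewrite (@zsum_nat _ _ K) => [|i i0|i Ki]; first last.
- by rewrite fN ?scaler0 //; lia.
- by rewrite kern_gt ?scale0r //; lia.
apply: eq_bigr => j _; have {1}-> : m = m + j%:Z - j%:Z by lia.
by rewrite [j%:Z + m]addrC -kernE; congr (kern _ _ _ *: _); lia.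
Qed.

Lemma kern_scale_finsupp a f m : finsupp (fun k => kern a k m *: f k).
Proof.
have [N fN] := laurent_bound f; apply: (@finsuppI _ _ m N) => k km.
  by rewrite kern_gt ?scale0r.
by rewrite fN ?scaler0.
Qed.

Lemma laurent_mulE f g m : (f * g) m = zsum (fun i => f i * g (m - i)).
Proof. by []. Qed.

Lemma laurent_shift0 f : shift (0 : C) f = f.
Proof.
apply: laurentP => m; rewrite laurent_shiftE -(zsum_shift _ m).
rewrite (@zsum_nat _ _ 1) => [|i i0|i i0]; first last.
- by rewrite kern0 (_ : i + m == m = false) ?scale0r //; lia.
- by rewrite kern0 (_ : i + m == m = false) ?scale0r //; lia.
by rewrite big_ord1 add0r kern0 eqxx scale1r.
Qed.

Lemma laurent_shiftD a b f : shift a (shift b f) = shift (a + b) f.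
Proof.
apply: laurentP => m; rewrite !laurent_shiftE.
have [N fN] := laurent_bound f.
transitivity (zsum (fun k => zsum (fun l => (kern a k m * kern b l k) *: f l))).
  apply: eq_zsum => k; rewrite laurent_shiftE.
  rewrite (zsum_map (phi := fun x => kern a k m *: x)) => [|x y|]; last first.
  - exact: kern_scale_finsupp.
  - exact: scalerBr.
  by apply: eq_zsum => l; rewrite scalerA.
rewrite zsum_exchange; last first.
  (* A nonzero term requires m <= k <= l <= N. *)
  apply: (@finsupp2I _ _ m N m N) => k l lt.
  - by rewrite kern_gt ?mul0r ?scale0r.
  - have [/fN ->|lN] := ltP N l; first by rewrite scaler0.
    by rewrite [X in _ * X]kern_gt ?mulr0 ?scale0r //; lia.
  - have [km|mk] := ltP k m; first by rewrite kern_gt ?mul0r ?scale0r.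
    by rewrite [X in _ * X]kern_gt ?mulr0 ?scale0r //; lia.
  - by rewrite fN ?scaler0.
apply: eq_zsum => l; rewrite kern_comp.
rewrite (zsum_map (phi := fun x => x *: f l)) => [//|x y|].
  exact: scalerBl.
apply: (@finsuppI _ _ m l) => k lt; first by rewrite kern_gt ?mul0r.
by rewrite [X in _ * X]kern_gt ?mulr0.
Qed.

(** Both sides expand into sums over the products f_i g_j; [kern_mul] identifies their weights. *)
Lemma laurent_shiftM a f g : shift a (f * g) = shift a f * shift a g.
Proof.
apply: laurentP => m; rewrite laurent_shiftE laurent_mulE.
have [N fN] := laurent_bound f; have [M gM] := laurent_bound g.
transitivity (zsum (fun i => zsum (fun j => kern a (i + j) m *: (f i * g j)))).
  transitivity (zsum (fun k => zsum (fun i => kern a k m *: (f i * g (k - i))))).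
    apply: eq_zsum => k; rewrite laurent_mulE.
    rewrite (zsum_map (phi := fun x => kern a k m *: x)) => [//|x y|].
      exact: scalerBr.
    apply: (@finsuppI _ _ (k - M) N) => i lt; last by rewrite fN ?mul0r.
    by rewrite [g _]gM ?mulr0 //; lia.
  rewrite zsum_exchange; last first.
    apply: (@finsupp2I _ _ m (N + M) (m - M) N) => k i lt.
    - by rewrite kern_gt ?scale0r.
    - have [/fN ->|iN] := ltP N i; first by rewrite mul0r scaler0.
      by rewrite [g _]gM ?mulr0 ?scaler0 //; lia.
    - have [km|mk] := ltP k m; first by rewrite kern_gt ?scale0r.
      by rewrite [g _]gM ?mulr0 ?scaler0 //; lia.
    - by rewrite fN ?mul0r ?scaler0.
  apply: eq_zsum => i; rewrite -(zsum_shift _ i); apply: eq_zsum => j.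
  by rewrite addrK addrC.
(* A nonzero term requires p <= i <= N and m - p <= j <= M, which justifies moving the sum over p
   innermost. *)
have kern2_0 p i j : [|| i < p, j < m - p, N < i | M < j] ->
    (kern a i p * kern a j (m - p)) *: (f i * g j) = 0.
  case/or4P => lt.
  - by rewrite kern_gt ?mul0r ?scale0r.
  - by rewrite [X in _ * X]kern_gt ?mulr0 ?scale0r.
  - by rewrite fN ?mul0r ?scaler0.
  - by rewrite gM ?mulr0 ?scaler0.
transitivity (zsum (fun p => zsum (fun i => zsum (fun j =>
    (kern a i p * kern a j (m - p)) *: (f i * g j))))); last first.
  apply: eq_zsum => p; rewrite !laurent_shiftE.
  rewrite (zsum_map (phi := fun x => x * _)) => [|x y|]; first last.
  - exact: kern_scale_finsupp.
  - exact: mulrBl.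
  apply: eq_zsum => i; rewrite (zsum_map (phi := fun x => _ * x)) => [|x y|]; first last.
  - exact: kern_scale_finsupp.
  - exact: mulrBr.
  by apply: eq_zsum => j; rewrite -scalerAl -scalerAr scalerA.
transitivity (zsum (fun i => zsum (fun p => zsum (fun j =>
    (kern a i p * kern a j (m - p)) *: (f i * g j))))); last first.
  apply/esym/zsum_exchange/(@finsupp2I _ _ (m - M) N (m - M) N) => p i lt;
    by apply: fsbig1 => j _; apply: kern2_0; lia.
apply: eq_zsum => i; rewrite zsum_exchange; last first.
  by apply: (@finsupp2I _ _ (m - M) i (m - i) M) => p j lt; apply: kern2_0; lia.
apply: eq_zsum => j; rewrite kern_mul.
rewrite (zsum_map (phi := fun x => x *: _)) => [//|x y|].
  exact: scalerBl.
apply: (@finsuppI _ _ (m - j) i) => p lt; last by rewrite kern_gt ?mul0r.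
by rewrite [X in _ * X]kern_gt ?mulr0 //; lia.
Qed.

(** * Linear functionals on series in u and v *)

Definition bounded2 h := exists N : int, forall p q, (N < p) || (N < q) -> h p q = 0.

Lemma prod_uv_bounded f g : bounded2 (prod_uv f g).
Proof.
have [N fN] := laurent_bound f; have [M gM] := laurent_bound g.
exists (`|N| + `|M|) => p q lt; rewrite /prod_uv.
by have [/fN ->|pN] := ltP N p; rewrite ?mul0r // gM ?mulr0 //; lia.
Qed.

Lemma prod_vu_bounded f g : bounded2 (prod_vu f g).
Proof.
by have [N H] := prod_uv_bounded f g; exists N => p q lt; apply: H; rewrite orbC.
Qed.

Lemma sub_bounded2 h h' : bounded2 h -> bounded2 h' -> bounded2 (h - h').
Proof.
move=> [N hN] [M hM]; exists (`|N| + `|M|) => p q lt.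
by rewrite -[LHS]/(h p q - h' p q) hN ?hM ?subr0 //; lia.
Qed.

(* The linear functional with value w p q on u^p v^q. *)
Definition pairing (w : int -> int -> C) h : R :=
  zsum (fun p => zsum (fun q => w p q *: h p q)).

(** Below any upper bound on the exponents the weight has bounded support, so its pairing with a
    [bounded2] series is a finite sum. *)
Definition bounded_below2 (w : int -> int -> C) := forall N, exists L : int,
  forall p q, p <= N -> q <= N -> (p < L) || (q < L) -> w p q = 0.

Lemma pairing_finsupp2 w h : bounded_below2 w -> bounded2 h ->
  finsupp2 (fun p q => w p q *: h p q).
Proof.
move=> wb [N hN]; have [L wL] := wb N; exists (`|N| + `|L|) => p q pq.
have [lt|/norP[]] := boolP ((N < p) || (N < q)); first by rewrite hN ?scaler0.
by rewrite -!leNgt => pN qN; rewrite wL ?scale0r //; lia.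
Qed.

Lemma pairingBr w h h' : bounded_below2 w -> bounded2 h -> bounded2 h' ->
  pairing w (h - h') = pairing w h - pairing w h'.
Proof.
move=> wb hb hb'; rewrite /pairing -zsum2B; try exact: pairing_finsupp2.
by apply: eq_zsum => p; apply: eq_zsum => q; rewrite -scalerBr.
Qed.

Lemma pairingBl w w' h : bounded_below2 w -> bounded_below2 w' -> bounded2 h ->
  pairing (fun p q => w p q - w' p q) h = pairing w h - pairing w' h.
Proof.
move=> wb wb' hb; rewrite /pairing -zsum2B; try exact: pairing_finsupp2.
by apply: eq_zsum => p; apply: eq_zsum => q; rewrite -scalerBl.
Qed.

(** Summation by parts: reindexing moves the factor u - v from the series to the weight. *)
Lemma pairing_mul_uv w h : bounded_below2 w -> bounded2 h ->
  pairing w (mul_uv h) = pairing (fun p q => w (p + 1) q - w p (q + 1)) h.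
Proof.
move=> wb hb.
have hbu : bounded2 (fun p q => h (p - 1) q).
  have [N hN] := hb; exists (N + 1) => p q lt; apply: hN; lia.
have hbv : bounded2 (fun p q => h p (q - 1)).
  have [N hN] := hb; exists (N + 1) => p q lt; apply: hN; lia.
rewrite (pairingBr wb hbu hbv) pairingBl //.
- congr (_ - _); rewrite /pairing.
    rewrite -[LHS](zsum_shift _ 1); apply: eq_zsum => p.
    by apply: eq_zsum => q; rewrite addrK.
  apply: eq_zsum => p; rewrite -[LHS](zsum_shift _ 1).
  by apply: eq_zsum => q; rewrite addrK.
- move=> N; have [L wL] := wb (N + 1); exists (L - 1) => p q pN qN lt; apply: wL; lia.
- move=> N; have [L wL] := wb (N + 1); exists (L - 1) => p q pN qN lt; apply: wL; lia.
Qed.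

(** * The substitution v = z - 1 and the simultaneous shift *)

Lemma zsum_kern_mulr a f m x :
  zsum (fun k => kern a k m *: (x * f k)) = x * shift a f m.
Proof.
rewrite laurent_shiftE (zsum_map (phi := fun y => x * y)) => [|y z|].
- by apply: eq_zsum => k; rewrite scalerAr.
- exact: mulrBr.
- exact: kern_scale_finsupp.
Qed.

Lemma zsum_kern_mull a f m x :
  zsum (fun k => kern a k m *: (f k * x)) = shift a f m * x.
Proof.
rewrite laurent_shiftE (zsum_map (phi := fun y => y * x)) => [|y z|].
- by apply: eq_zsum => k; rewrite scalerAl.
- exact: mulrBl.
- exact: kern_scale_finsupp.
Qed.

(* The coefficient of z^m after the substitution u = z, v = z - 1. *)
Definition spec_weight m : int -> int -> C := fun p q => kern (-1) q (m - p).

Lemma spec_weight_bounded m : bounded_below2 (spec_weight m).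
Proof.
by move=> N; exists (m - N) => p q pN qN lt; apply: kern_gt; lia.
Qed.

(** The factor u - v becomes z - (z - 1) = 1; on weights this is [kernS] with a = -1. *)
Lemma spec_mul_uv m h : bounded2 h ->
  pairing (spec_weight m) (mul_uv h) = pairing (spec_weight m) h.
Proof.
move=> hb; rewrite pairing_mul_uv //; last exact: spec_weight_bounded.
apply: eq_zsum => p; apply: eq_zsum => q; congr (_ *: _).
by rewrite /spec_weight kernS mulN1r opprD addrA subKr.
Qed.

Lemma spec_prod_uv m f g :
  pairing (spec_weight m) (prod_uv f g) = (f * shift (-1 : C) g) m.
Proof. by apply: eq_zsum => p; apply: zsum_kern_mulr. Qed.

Lemma spec_prod_vu m f g :
  pairing (spec_weight m) (prod_vu f g) = (shift (-1 : C) f * g) m.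
Proof.
rewrite laurent_mulE -[RHS](zsum_opp _ m); apply: eq_zsum => p.
by rewrite subKr; apply: zsum_kern_mull.
Qed.

Lemma laurent_yangian_spec n (T : 'M[laurent R]_n) : laurent_yangian T ->
  forall i j k l,
  T i j * shift (-1 : C) (T k l) - shift (-1 : C) (T k l) * T i j =
  T k j * shift (-1 : C) (T i l) - shift (-1 : C) (T k j) * T i l.
Proof.
move=> /laurent_yangianE Ty i j k l; apply: laurentP => m.
rewrite !laurentDE !laurentNE -!spec_prod_uv -!spec_prod_vu.
have wb := spec_weight_bounded m.
have hu := prod_uv_bounded; have hv := prod_vu_bounded.
(* [Ty] rewrites the right-hand side as u - v times the commutator, and the functional ignores that
   factor. *)
rewrite -!(pairingBr wb (hu _ _) (hv _ _)) -Ty spec_mul_uv //.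
exact: sub_bounded2.
Qed.

(* The coefficient of u^p v^q after the shift of both u and v by c. *)
Definition shift2_weight c p q : int -> int -> C :=
  fun k l => kern c k p * kern c l q.

Lemma shift2_weight_bounded c p q : bounded_below2 (shift2_weight c p q).
Proof.
move=> N; exists (- (`|p| + `|q|)) => k l _ _ lt; rewrite /shift2_weight.
have [kp|pk] := ltP k p; first by rewrite kern_gt ?mul0r.
have [lq|ql] := ltP l q; first by rewrite [X in _ * X]kern_gt ?mulr0.
by lia.
Qed.

(** The reason is (u + c) - (v + c) = u - v: in [kernS] the two terms with factor c cancel. *)
Lemma shift2_mul_uv c p q h : bounded2 h ->
  pairing (shift2_weight c p q) (mul_uv h) =
  mul_uv (fun p q => pairing (shift2_weight c p q) h) p q.
Proof.
move=> hb; have wb := shift2_weight_bounded c.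
rewrite pairing_mul_uv // /mul_uv -pairingBl //.
apply: eq_zsum => k; apply: eq_zsum => l; congr (_ *: _).
by rewrite /shift2_weight !kernS; ring.
Qed.

Lemma shift2_prod_uv c f g :
  (fun p q => pairing (shift2_weight c p q) (prod_uv f g)) =
  prod_uv (shift c f) (shift c g).
Proof.
apply/funext => p; apply/funext => q; rewrite /prod_uv -zsum_kern_mull.
apply: eq_zsum => k; rewrite scalerAl -zsum_kern_mulr; apply: eq_zsum => l.
by rewrite -scalerAl scalerA [in RHS]mulrC.
Qed.

Lemma shift2_prod_vu c f g :
  (fun p q => pairing (shift2_weight c p q) (prod_vu f g)) =
  prod_vu (shift c f) (shift c g).
Proof.
apply/funext => p; apply/funext => q; rewrite /prod_vu -zsum_kern_mulr.
apply: eq_zsum => k; rewrite scalerAr -zsum_kern_mull; apply: eq_zsum => l.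
by rewrite -scalerAr scalerA [in RHS]mulrC.
Qed.

(** Each coefficient of the shifted relation is a functional applied to the relation cleared of 1 /
    (u - v). *)
Lemma laurent_yangian_shift c n (T : 'M[laurent R]_n) :
  laurent_yangian T -> laurent_yangian (map_mx (shift c) T).
Proof.
move=> /laurent_yangianE Ty; apply/laurent_yangianE => i j k l; rewrite !mxE.
have hu := prod_uv_bounded; have hv := prod_vu_bounded.
have shift2B f g f' g' : prod_uv (shift c f) (shift c g) -
    prod_vu (shift c f') (shift c g') = fun p q =>
    pairing (shift2_weight c p q) (prod_uv f g - prod_vu f' g').
  rewrite -shift2_prod_uv -shift2_prod_vu; apply/funext => p; apply/funext => q.
  by rewrite (pairingBr (@shift2_weight_bounded c p q) (hu _ _) (hv _ _)).
rewrite !shift2B -Ty; apply/funext => p; apply/funext => q.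
by rewrite -shift2_mul_uv //; apply: sub_bounded2.
Qed.
End LaurentShiftTheory.

Theorem proposition4 (K : realType) (R : algType K[i]) (n : nat) :
  (forall T : 'M[laurent R]_n, laurent_yangian T ->
    [/\ manin (mx_shiftop T (-1)),
        manin (shiftop_mx 1 T)^T &
        forall c : K[i],
          [/\ laurent_yangian (map_mx (shift c) T),
              mx_shiftop (map_mx (shift c) T) (-1) =
                shiftop_mx (-1) (map_mx (shift (c + 1)) T),
              manin (mx_shiftop (map_mx (shift c) T) (-1)),
              (shiftop_mx 1 (map_mx (shift c) T))^T =
                (mx_shiftop (map_mx (shift (c + 1)) T) 1)^T &
              manin (shiftop_mx 1 (map_mx (shift c) T))^T]]) /\
  (forall T : 'M[ratfun R]_n, ratfun_yangian T ->
    [/\ manin (mx_shiftop T (-1)),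
        manin (shiftop_mx 1 T)^T &
        forall c : K[i],
          [/\ ratfun_yangian (map_mx (shift c) T),
              mx_shiftop (map_mx (shift c) T) (-1) =
                shiftop_mx (-1) (map_mx (shift (c + 1)) T),
              manin (mx_shiftop (map_mx (shift c) T) (-1)),
              (shiftop_mx 1 (map_mx (shift c) T))^T =
                (mx_shiftop (map_mx (shift (c + 1)) T) 1)^T &
              manin (shiftop_mx 1 (map_mx (shift c) T))^T]]).
Proof.
split=> T.
  apply: yangian_manin => {T}.
  - exact: laurent_shiftM.
  - exact: laurent_shiftD.
  - exact: laurent_shift0.
  - exact: laurent_yangian_spec.
  - by move=> c T; apply: laurent_yangian_shift.
apply: yangian_manin => {T}.
- exact: ratfun_shiftM.
- exact: ratfun_shiftD.
- exact: ratfun_shift0.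
- exact: ratfun_yangian_spec.
- by move=> c T; apply: ratfun_yangian_shift.
Qed.
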